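(* For each positive integer $n$ let $Q$ be a random real symmetric $n\times n$ matrix whose diagonal entries $(Q_{ii})_i$ and off-diagonal entries $(Q_{ij})_{i<j}$ are mutually independent, the diagonal entries being i.i.d. with distribution function $F_D$ and the off-diagonal entries being i.i.d. with distribution function $F_O$, both laws absolutely continuous with respect to Lebesgue measure. Let $m_n:=\min_{1\le i\le n}Q_{ii}$. Assume $$F_D(-x)\sim c_Dx^{-\alpha_D},\qquad F_O(-x)\sim c_Ox^{-\alpha_O},\qquad x\to\infty,$$ with $c_D,c_O>0$ and $\alpha_D,\alpha_O>0$. If $$\alpha_O>\frac54\,\alpha_D,$$ then $n^5\,\mathbb{E}\bigl[F_O(m_n)^4\bigr]\to0$ as $n\to\infty$.
   Context: $f(x)\sim g(x)$ as $x\to\infty$ means $f(x)/g(x)\to1$. *)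

(* Defs.v *)
From HB Require Import structures.
From mathcomp Require Import all_boot all_order all_algebra.
From mathcomp Require Import all_classical all_reals all_analysis.

Set Implicit Arguments.
Unset Strict Implicit.
Unset Printing Implicit Defensive.

Import Order.TTheory GRing.Theory Num.Theory.
Import numFieldNormedType.Exports.

Local Open Scope classical_set_scope.
Local Open Scope ring_scope.

Definition asymptotic_at_infinity (R : realType) (f g : R -> R) : Prop :=
  f x / g x @[x --> +oo] --> (1 : R).

Definition mutually_independent (d : measure_display) (T : measurableType d)
    (R : realType) (P : probability T R) (I : finType) (D : {set I})
    (X : I -> {RV P >-> R}) : Prop :=
  forall (J : {set I}) (B : I -> set R), J \subset D ->
    (forall i, i \in J -> measurable (B i)) ->
    P (\bigcap_(i in [set` J]) (X i @^-1` B i)) =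
    (\prod_(i in J) P (X i @^-1` B i))%E.

(* For a symmetric matrix, the entries on and above the diagonal are the
   "diagonal and off-diagonal entries (i < j)". *)
Definition upper_entries_independent (d : measure_display)
    (T : measurableType d) (R : realType) (P : probability T R) (n : nat)
    (Q : 'M[{RV P >-> R}]_n) : Prop :=
  mutually_independent [set p : 'I_n * 'I_n | (p.1 <= p.2)%N]%SET
    (fun p => Q p.1 p.2).

(* The initial value of the fold is itself a diagonal entry, so that this is
   the minimum of the (nonempty) diagonal. *)
Definition min_diag (d : measure_display) (T : measurableType d)
    (R : realType) (P : probability T R) (n : nat)
    (Q : 'M[{RV P >-> R}]_n.+1) (w : T) : R :=
  \big[Num.min/Q ord0 ord0 w]_(i < n.+1) Q i i w.

(* Main.v *)
(* Cut at the level y = - n^s, where 5 / (4 alpha_O) < s < 1 / alpha_D; such an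
   s exists exactly because alpha_O > (5/4) alpha_D.  On [m_n <= y] monotonicity
   gives F_O(m_n)^4 <= F_O(y)^4 = O(n^(- 4 s alpha_O)) with 4 s alpha_O > 5.
   By independence P(m_n > y) = (1 - F_D(y))^n <= exp(- n F_D(y)), and n F_D(y)
   grows at least like a positive power of n, which beats the factor n^5. *)
Require Import Defs.
From HB Require Import structures.
From mathcomp Require Import all_boot all_order all_algebra.
From mathcomp Require Import all_classical all_reals all_analysis.
From mathcomp Require Import measurable_realfun ring lra.

Set Implicit Arguments.
Unset Strict Implicit.
Unset Printing Implicit Defensive.

Import Order.TTheory GRing.Theory Num.Theory.
Import numFieldNormedType.Exports.

Local Open Scope classical_set_scope.
Local Open Scope ring_scope.

Lemma powR_cvgy (R : realType) (e : R) : 0 < e ->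
  x `^ e @[x --> +oo] --> +oo.
Proof.
move=> e0; apply/cvgryPge => A.
(* Truncation at 0, because a negative [A] is not recovered as the [e]-th power of [A] to the
   [e^-1]. *)
pose B := Num.max 0 A.
have B0 : 0 <= B by rewrite le_max lexx.
near=> x; apply: (@le_trans _ _ B); first by rewrite le_max lexx orbT.
have -> : B = (B `^ e^-1) `^ e by rewrite -powRrM mulVf ?gt_eqF// powRr1.
have Bx : B `^ e^-1 <= x by near: x; apply: nbhs_pinfty_ge; exact: num_real.
apply: (ge0_ler_powR (ltW e0)) => //; rewrite nnegrE ?powR_ge0//.
Unshelve. all: by end_near. Qed.

Lemma powRN_cvg0 (R : realType) (e : R) : 0 < e ->
  x `^ (- e) @[x --> +oo] --> 0.
Proof.
move=> e0; under eq_fun do rewrite powRN.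
apply/(gtr0_cvgV0 (f := fun x => x `^ e)); last exact: powR_cvgy.
near=> x; apply: powR_gt0.
by near: x; apply: nbhs_pinfty_gt; exact: num_real.
Unshelve. all: by end_near. Qed.

(** The single term [u ^+ k.+1 / (k.+1)!] of the exponential series is a lower bound for [expR u];
    take inverses. *)
Lemma expRN_le (R : realType) (k : nat) (u : R) : 0 < u ->
  expR (- u) <= (k.+1)`!%:R * u ^- k.+1.
Proof.
move=> u0; have f0 : 0 < (k.+1)`!%:R :> R by rewrite ltr0n fact_gt0.
have uk0 : 0 < u ^+ k.+1 by rewrite exprn_gt0.
rewrite expRN -[_ * _]invrK invfM invrK mulrC lef_pV2 ?posrE ?expR_gt0//.
  by apply: le_trans (expR_ge1Dxn k (ltW u0)); rewrite lerDr.
by rewrite divr_gt0.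
Qed.

Lemma exprM_expRN_cvg0 (R : realType) (p : nat) (K e : R) : 0 < K -> 0 < e ->
  x ^+ p * expR (- (K * x `^ e)) @[x --> +oo] --> 0.
Proof.
move=> K0 e0.
(* With this [k], [expRN_le] turns the exponential into a power of exponent
   [- e * k.+1 <= - (p + 1)], so the product is at most [C / x] for [x >= 1]. *)
pose k := Num.truncn ((p%:R + 1) / e).
have ek : p%:R + 1 <= e * k.+1%:R.
  by rewrite mulrC -ler_pdivrMr// ltW// truncnS_gt.
pose C : R := (k.+1)`!%:R * K ^- k.+1.
have C0 : 0 <= C by rewrite mulr_ge0 ?ler0n// invr_ge0 exprn_ge0// ltW.
apply: (@squeeze_cvgr _ _ _ _ (cst 0) (fun x : R => C * x `^ (- 1)));
  last 2 first.
- exact: cvg_cst.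
- by rewrite -[X in _ --> X](mulr0 C); apply: cvgMr; apply: powRN_cvg0.
near=> x.
have x1 : 1 <= x by near: x; apply: nbhs_pinfty_ge; exact: num_real.
have x0 : 0 < x := lt_le_trans ltr01 x1.
have Kx : 0 < K * x `^ e by rewrite mulr_gt0// powR_gt0.
rewrite mulr_ge0 ?exprn_ge0 ?expR_ge0 ?(ltW x0)//=.
apply: (le_trans (ler_wpM2l (exprn_ge0 _ (ltW x0)) (expRN_le k Kx))).
have -> : x ^+ p * ((k.+1)`!%:R * (K * x `^ e) ^- k.+1) =
    C * (x ^+ p * (x `^ e) ^- k.+1) by rewrite exprMn invfM /C; ring.
apply: ler_wpM2l => //.
rewrite -[_ ^+ k.+1]powR_mulrn ?powR_ge0// -powRrM -powRN.
rewrite -[x ^+ p]powR_mulrn ?(ltW x0)// -powRD;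
  last by rewrite (gt_eqF x0) implybT.
by apply: ler_powR => //; lra.
Unshelve. all: by end_near. Qed.

(** This is [1 - q <= expR (- q)] raised to the power [N]; [q <= 1] keeps the base nonnegative. *)
Lemma exprB1_le_expR (R : realType) (q : R) (N : nat) : q <= 1 ->
  (1 - q) ^+ N <= expR (- (q * N%:R)).
Proof.
move=> q1; rewrite -mulNr expRM_natr lerXn2r ?nnegrE ?expR_ge0 ?subr_ge0//.
exact: expR_ge1Dx.
Qed.

(** The ratio tends to 1, hence ends up between 1/2 and 2. The lower bound will serve [F_D], the
    upper one [F_O]. *)
Lemma asymptotic_bounds (R : realType) (f g : R -> R) :
  asymptotic_at_infinity f g -> (\forall x \near +oo, 0 < g x) ->
  \forall x \near +oo, g x / 2 <= f x <= 2 * g x.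
Proof.
move=> fg g0; near=> x.
have gx0 : 0 < g x by near: x.
have lb : 2^-1 <= f x / g x.
  by near: x; apply: (cvgr_ge (1 : R) fg); rewrite invf_lt1// ltr1n.
have ub : f x / g x <= 2.
  by near: x; apply: (cvgr_le (1 : R) fg); rewrite ltr1n.
by rewrite mulrC -ler_pdivlMr// lb -ler_pdivrMr.
Unshelve. all: by end_near. Qed.

Lemma measurable_min_diag (d : measure_display) (T : measurableType d)
    (R : realType) (P : probability T R) (n : nat)
    (Q : 'M[{RV P >-> R}]_n.+1) :
  measurable_fun [set: T] (min_diag Q).
Proof.
rewrite /min_diag; elim: (index_enum _) => [|i s IHs].
  by under eq_fun do rewrite big_nil; exact: measurable_funPT.
by under eq_fun do rewrite big_cons; exact: measurable_minr.
Qed.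

Lemma probability_min_diag_gt (d : measure_display) (T : measurableType d)
    (R : realType) (P : probability T R) (n : nat)
    (Q : 'M[{RV P >-> R}]_n.+1) (F : R -> R) (y : R) :
  upper_entries_independent Q ->
  (forall i, cdf (Q i i) y = (F y)%:E) ->
  P [set w | y < min_diag Q w] = ((1 - F y) ^+ n.+1)%:E.
Proof.
move=> indQ FQ.
(* The diagonal positions form a subset of the upper triangle, so independence applies to them; the
   minimum exceeds [y] exactly when all these entries do. *)
pose J := [set (i, i) | i in 'I_n.+1]%SET.
have -> : [set w | y < min_diag Q w] =
    \bigcap_(p in [set` J]) ((fun w => Q p.1 p.2 w) @^-1` `]y, +oo[%classic).
  apply/seteqP; split => w /=.
    move=> /bigmin_gtP[_ yQ] p /= /imsetP[i _ ->] /=.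
    by rewrite in_itv/= yQ.
  move=> yQ; have {}yQ i : y < Q i i w.
    have /= := yQ (i, i); rewrite in_itv/= andbT; apply.
    by apply/imsetP; exists i.
  by apply/bigmin_gtP; split.
rewrite (indQ J (fun=> `]y, +oo[%classic)); last 2 first.
- by apply/fintype.subsetP => p /imsetP[i _ ->]; rewrite inE.
- by move=> *; exact: measurable_itv.
rewrite big_imset/=; last by move=> i j _ _ [].
transitivity (\prod_(i < n.+1) (1 - F y)%:E)%E.
  apply: eq_bigr => i _.
  by rewrite EFinB -(FQ i); exact: (ccdf_1_cdf (Q i i)).
by rewrite prodEFin prodr_const card_ord.
Qed.

(** Pointwise, [G (X w)] is at most [G y] plus the indicator of [y < X w]: by monotonicity when
    [X w <= y], and by [G <= 1] otherwise. Integrate. *)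
Lemma expectation_nondecreasing_comp_le (d : measure_display)
    (T : measurableType d) (R : realType) (P : probability T R)
    (X : T -> R) (G : R -> R) (y : R) :
  measurable_fun [set: T] X -> {homo G : x z / x <= z} ->
  (forall x, 0 <= G x <= 1) ->
  ('E_P[(G \o X)] <= (G y)%:E + P [set w | (y < X w)%R])%E.
Proof.
move=> mX ndG G01.
have mA : measurable [set w | (y < X w)%R].
  have -> : [set w | (y < X w)%R] = [set: T] `&` X @^-1` `]y, +oo[%classic.
    by apply/seteqP; split => w /=; rewrite in_itv/= andbT // => -[].
  exact: mX.
have mG : measurable_fun [set: T] (G \o X).
  by apply: measurableT_comp => //; exact: nondecreasing_measurable.
rewrite unlock.
apply: (@le_trans _ _
    (\int[P]_w ((G y)%:E + (\1_[set w | (y < X w)%R] w)%:E))%E).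
  apply: ge0_le_integral => //.
  - by move=> w _; rewrite lee_fin; have /andP[] := G01 (X w).
  - exact/measurable_EFinP.
  - by apply: emeasurable_funD => //; apply/measurable_EFinP/measurable_indic.
  - move=> w _; rewrite -EFinD lee_fin indicE.
    have /andP[Gy0 _] := G01 y; have /andP[_ Gw1] := G01 (X w).
    have [wy|wy] := leP (X w) y.
      rewrite memNset ?addr0; first exact: ndG.
      by rewrite /= ltNge wy.
    by rewrite mem_set//= (le_trans Gw1)// lerDr.
rewrite ge0_integralD//; first last.
- exact/measurable_EFinP/measurable_indic.
- by move=> w _; rewrite lee_fin; have /andP[] := G01 y.
by rewrite integral_cst// [X in (_ * X)%E]probability_setT mule1
  integral_indic// setIT.
Qed.

(* The positive integers are written n.+1: Q n is the matrix of size n.+1. *)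
Theorem proposition7p2 (R : realType)
  (d : nat -> measure_display) (T : forall n : nat, measurableType (d n))
  (P : forall n : nat, probability (T n) R)
  (Q : forall n : nat, 'M[{RV (P n) >-> R}]_n.+1)
  (F_D F_O : R -> R) (c_D c_O alpha_D alpha_O : R)
  (Qsym : forall n : nat, (Q n)^T = Q n)
  (Qindep : forall n : nat, upper_entries_independent (Q n))
  (cdf_D : forall (n : nat) (i : 'I_n.+1) (x : R),
     cdf (Q n i i) x = (F_D x)%:E)
  (cdf_O : forall (n : nat) (i j : 'I_n.+1) (x : R), (i < j)%N ->
     cdf (Q n i j) x = (F_O x)%:E)
  (ac_D : forall (n : nat) (i : 'I_n.+1),
     distribution (P n) (Q n i i) `<< @lebesgue_measure R)
  (ac_O : forall (n : nat) (i j : 'I_n.+1), (i < j)%N ->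
     distribution (P n) (Q n i j) `<< @lebesgue_measure R)
  (c_D_gt0 : 0 < c_D) (c_O_gt0 : 0 < c_O)
  (alpha_D_gt0 : 0 < alpha_D) (alpha_O_gt0 : 0 < alpha_O)
  (tail_D : asymptotic_at_infinity
     (fun x : R => F_D (- x)) (fun x : R => c_D * x `^ (- alpha_D)))
  (tail_O : asymptotic_at_infinity
     (fun x : R => F_O (- x)) (fun x : R => c_O * x `^ (- alpha_O)))
  (alpha_lt : 5 / 4 * alpha_D < alpha_O) :
  ((n.+1%:R ^+ 5)%:E *
     'E_(P n)[(fun w : T n => F_O (min_diag (Q n) w) ^+ 4)%R])%E
    @[n --> \oo] --> 0%E.
Proof.
(* The midpoint of the admissible interval; [sO] and [sD] below say that it lies strictly inside. *)
pose s := (5 / 4 / alpha_O + alpha_D^-1) / 2.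
have sO : 5 < 4 * (s * alpha_O).
  have : 1 < alpha_O / alpha_D * (4 / 5).
    by rewrite mulrAC ltr_pdivlMr//; lra.
  have -> : 4 * (s * alpha_O) = 5 / 2 + 2 * (alpha_O / alpha_D).
    by rewrite /s; field; rewrite !gt_eqF.
  lra.
have sD : s * alpha_D < 1.
  have : 5 / 4 * alpha_D / alpha_O < 1 by rewrite ltr_pdivrMr// mul1r.
  have -> : s * alpha_D = (5 / 4 * alpha_D / alpha_O + 1) / 2.
    by rewrite /s; field; rewrite !gt_eqF.
  lra.
have s0 : 0 < s by rewrite divr_gt0// addr_gt0 ?divr_gt0 ?invr_gt0.
have F_D01 x : 0 <= F_D x <= 1.
  by rewrite -!lee_fin -(cdf_D 0 ord0) cdf_ge0 cdf_le1.
(* Index 1, that is size 2, is the smallest matrix with an off-diagonal entry from which to read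
   [F_O]. *)
have F_O01 x : 0 <= F_O x <= 1.
  by rewrite -!lee_fin -(@cdf_O 1 ord0 ord_max)// cdf_ge0 cdf_le1.
have F_O_nd : {homo F_O : x y / x <= y}.
  move=> x y xy; rewrite -lee_fin -!(@cdf_O 1 ord0 ord_max)//.
  exact: cdf_nondecreasing.
have N_cvgy : (n.+1%:R : R) @[n --> \oo] --> +oo.
  by rewrite (cvg_shiftS (fun n => n%:R : R)); exact: cvgr_idn.
pose y n : R := - n.+1%:R `^ s.
(* At [x = n.+1], the summands are [x ^+ 5] times the bound for [F_O (y n) ^+ 4] and [x ^+ 5] times
   the bound for the probability that the minimum exceeds [y n]. *)
pose B (x : R) := (2 * c_O) ^+ 4 * x `^ (- (4 * (s * alpha_O) - 5)) +
  x ^+ 5 * expR (- (c_D / 2 * x `^ (1 - s * alpha_D))).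
have B0 : B x @[x --> +oo] --> 0.
  rewrite -[X in _ --> X]addr0; apply: cvgD; last first.
    by apply: exprM_expRN_cvg0; rewrite ?divr_gt0// subr_gt0.
  by rewrite -[X in _ --> X](mulr0 ((2 * c_O) ^+ 4)); apply: cvgMr;
    apply: powRN_cvg0; rewrite subr_gt0.
apply: (@squeeze_cvge _ _ _ _ (cst 0%E) _ (fun n => (B n.+1%:R)%:E)).
- have powgt0 c e : 0 < c -> \forall x \near +oo, 0 < c * x `^ (- e) :> R.
    by move=> c0; exists 0; split=> // x x0; rewrite mulr_gt0// powR_gt0.
  have zy : (n.+1%:R : R) `^ s @[n --> \oo] --> +oo.
    exact: (cvg_comp _ _ N_cvgy (powR_cvgy s0)).
  (* The tail bounds are pulled back along [n.+1 ^ s], which is [- y n] and tends to infinity. *)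
  have := zy _ (asymptotic_bounds tail_O (powgt0 _ alpha_O c_O_gt0)).
  have := zy _ (asymptotic_bounds tail_D (powgt0 _ alpha_D c_D_gt0)).
  rewrite !near_simpl => nearD nearO.
  near=> n.
  have N0 : 0 < n.+1%:R :> R by rewrite ltr0n.
  have /andP[_ FO] : c_O * (n.+1%:R `^ s) `^ (- alpha_O) / 2 <= F_O (y n) <=
      2 * (c_O * (n.+1%:R `^ s) `^ (- alpha_O)) by near: n.
  have /andP[FD _] : c_D * (n.+1%:R `^ s) `^ (- alpha_D) / 2 <= F_D (y n) <=
      2 * (c_D * (n.+1%:R `^ s) `^ (- alpha_D)) by near: n.
  have G01 x : 0 <= F_O x ^+ 4 <= 1.
    by have /andP[? ?] := F_O01 x; rewrite exprn_ge0// exprn_ile1.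
  have G_nd : {homo (fun x => F_O x ^+ 4) : x z / x <= z}.
    move=> x z xz; have /andP[? _] := F_O01 x; have /andP[? _] := F_O01 z.
    by rewrite lerXn2r ?nnegrE// F_O_nd.
  have N5 : (0 <= (n.+1%:R ^+ 5)%:E :> \bar R)%E by rewrite lee_fin exprn_ge0.
  apply/andP; split.
    rewrite /= mule_ge0// expectation_ge0// => w.
    by have /andP[] := G01 (min_diag (Q n) w).
  apply: (le_trans (lee_wpmul2l N5 (expectation_nondecreasing_comp_le (P n)
    (y n) (measurable_min_diag (Q n)) G_nd G01))).
  rewrite (probability_min_diag_gt (Qindep n) (fun i => cdf_D n i (y n))).
  rewrite -EFinD -EFinM lee_fin mulrDr lerD//.
    have /andP[FO0 _] := F_O01 (y n).
    apply: (@le_trans _ _ (n.+1%:R ^+ 5 *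
        (2 * (c_O * (n.+1%:R `^ s) `^ (- alpha_O))) ^+ 4)).
      by rewrite ler_wpM2l ?exprn_ge0// lerXn2r ?nnegrE// (le_trans FO0).
    (* Once the constant is factored out, the powers of [n.+1] combine to the exponent
       [5 - 4 * (s * alpha_O)]. *)
    rewrite mulrA exprMn mulrCA ler_wpM2l ?exprn_ge0 ?mulr_ge0 ?(ltW c_O_gt0)//.
    rewrite -powRrM -[X in _ * X]powR_mulrn ?powR_ge0// -powRrM.
    rewrite -[X in X * _]powR_mulrn ?(ltW N0)//.
    rewrite -powRD; last by rewrite (gt_eqF N0) implybT.
    by rewrite ler_powR// ?ler1n//; lra.
  have /andP[_ FD1] := F_D01 (y n).
  rewrite ler_wpM2l ?exprn_ge0//.
  apply: (le_trans (exprB1_le_expR _ FD1)).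
  (* Splitting [x ^ (1 - s * alpha_D)] as [x] times [x ^ (- s * alpha_D)] cancels the factor [n.+1]
     and leaves the lower tail bound [FD]. *)
  rewrite ler_expR lerN2 powRD; last by rewrite (gt_eqF N0) implybT.
  rewrite powRr1 ?(ltW N0)// mulrCA mulrC ler_wpM2r ?(ltW N0)//.
  by rewrite -mulrN powRrM mulrAC.
- exact: cvg_cst.
- apply: cvg_EFin; first by near=> n.
  exact: (cvg_comp _ _ N_cvgy B0).
Unshelve. all: by end_near. Qed.
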